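(* For an $n\times n$ matrix $\mathbf{M}$ (real, non-negative, with no zero rows and no zero columns), $\mathrm{CI}(\mathbf{M})\ge\frac1n$, with equality when $\mathbf{M}$ is uniformly distributed (i.e. all entries of $\mathbf{M}$ are equal).
   Context: Sinkhorn (SK) iteration of $\mathbf{M}$ generates the sequence $\mathbf{L}^1,\mathbf{T}^1,\mathbf{L}^2,\mathbf{T}^2,\dots$, where $\mathbf{L}^1$ is the row normalization of $\mathbf{M}$ (each row divided by its sum), $\mathbf{T}^k$ is the column normalization of $\mathbf{L}^k$ (each column divided by its sum), and $\mathbf{L}^{k+1}$ is the row normalization of $\mathbf{T}^k$. The sequences $\mathbf{L}^k$ and $\mathbf{T}^k$ converge to limits $\mathbf{L}=(l_{ij})$ and $\mathbf{T}=(t_{ij})$. The cooperative index of an $n\times n$ matrix is $\mathrm{CI}(\mathbf{M})=\frac1n\sum_{i,j=1}^n l_{ij}t_{ij}$. *)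

(* Defs.v *)
From HB Require Import structures.
From mathcomp Require Import all_boot all_order all_algebra.
From mathcomp Require Import all_classical all_reals all_analysis.
Set Implicit Arguments.
Unset Strict Implicit.
Unset Printing Implicit Defensive.
Import Order.TTheory GRing.Theory Num.Theory.
Import numFieldNormedType.Exports.
Local Open Scope ring_scope.

Definition row_normalize (R : realType) (m n : nat) (A : 'M[R]_(m, n)) :
  'M[R]_(m, n) := \matrix_(i, j) (A i j / \sum_k A i k).

Definition col_normalize (R : realType) (m n : nat) (A : 'M[R]_(m, n)) :
  'M[R]_(m, n) := \matrix_(i, j) (A i j / \sum_k A k j).

(* Indices start at 0: [sinkhorn_L M k] is L^(k+1) and [sinkhorn_T M k] is
   T^(k+1), so that both sequences start with L^1 and T^1. *)
Fixpoint sinkhorn_L (R : realType) (m n : nat) (M : 'M[R]_(m, n)) (k : nat) :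
  'M[R]_(m, n) :=
  if k is k'.+1 then row_normalize (col_normalize (sinkhorn_L M k'))
  else row_normalize M.

Definition sinkhorn_T (R : realType) (m n : nat) (M : 'M[R]_(m, n)) (k : nat) :
  'M[R]_(m, n) := col_normalize (sinkhorn_L M k).

(* [limn] is total; it is the genuine limit because both sequences converge
   for every nonnegative matrix without zero rows or columns, including those
   without a positive diagonal, for which the two limits differ. *)
Definition limit_L (R : realType) (m n : nat) (M : 'M[R]_(m, n)) :
  'M[R]_(m, n) := limn (sinkhorn_L M).

Definition limit_T (R : realType) (m n : nat) (M : 'M[R]_(m, n)) :
  'M[R]_(m, n) := limn (sinkhorn_T M).

Definition cooperative_index (R : realType) (n : nat) (M : 'M[R]_n) : R :=
  n%:R^-1 * \sum_i \sum_j limit_L M i j * limit_T M i j.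

(* Main.v *)
(* Convergence. The iteration alternately minimizes the relative entropy
   D(L || T) between row-stochastic and column-stochastic matrices. Hence the
   entropy sum_j c_j ln c_j = D(L^k || T^k) of the column sums of L^k is
   nonincreasing. If p is the limit of L^k along an ultrafilter, comparing
   these entropies with that of p shows (the Csiszar-Tusnady argument) that
   sum_ij p_ij ln L^k_ij is nondecreasing, i.e. that D(p || L^k) is
   nonincreasing; since D(p || L^k) tends to 0 along the ultrafilter, it tends
   to 0, so L^k converges to p. The column sums of L^k stay away from 0, hence
   T^k converges to the column normalization of p.

   Bound. With c_j the column sums of p, sum_ij l_ij t_ij is
   sum_j (sum_i p_ij^2) / c_j, which by Cauchy-Schwarz is at least
   sum_j c_j / n = 1. *)
Require Import Defs.
From HB Require Import structures.
From mathcomp Require Import all_boot all_order all_algebra.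
From mathcomp Require Import all_classical all_reals all_analysis.
From mathcomp Require Import ring lra.
Set Implicit Arguments.
Unset Strict Implicit.
Unset Printing Implicit Defensive.
Import Order.TTheory GRing.Theory Num.Theory.
Import numFieldNormedType.Exports.
Local Open Scope ring_scope.

Local Notation row_sum A i := (\sum_j A i j).
Local Notation col_sum A j := (\sum_i A i j).

Lemma mulr_ln_le (R : realType) (w x : R) :
  0 <= w -> 0 < x -> w * ln x <= w * x - w.
Proof.
move=> w0 x0; rewrite -[X in _ <= _ - X]mulr1 -mulrBr ler_wpM2l//.
by have := @le_ln1Dx R (x - 1); rewrite subrKC; apply; rewrite ltrBrDl subrr.
Qed.

Lemma hellinger_le_relative_entropy (R : realType) (x y : R) :
  0 <= x -> 0 <= y -> (x != 0 -> y != 0) ->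
  x - y + (Num.sqrt x - Num.sqrt y) ^+ 2 <= x * (ln x - ln y).
Proof.
move=> x0 y0 xy; have [->|xN0] := eqVneq x 0.
  by rewrite sqrtr0 !sub0r sqrrN sqr_sqrtr// mul0r addNr.
have {}x0 : 0 < x by rewrite lt_def xN0.
have {}y0 : 0 < y by rewrite lt_def xy.
set a := Num.sqrt x; set b := Num.sqrt y.
have a0 : 0 < a by rewrite sqrtr_gt0.
have b0 : 0 < b by rewrite sqrtr_gt0.
have -> : x = a ^+ 2 by rewrite sqr_sqrtr// ltW.
have -> : y = b ^+ 2 by rewrite sqr_sqrtr// ltW.
have := @mulr_ln_le R (a ^+ 2) (b / a) (sqr_ge0 a) (divr_gt0 b0 a0).
rewrite ln_div ?posrE// !lnXn// (_ : a ^+ 2 * (b / a) = a * b); last first.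
  by field; rewrite gt_eqF.
by rewrite !mulr2n; nra.
Qed.

Definition nonneg_full (R : realType) (m n : nat) (A : 'M[R]_(m, n)) :=
  [/\ forall i j, 0 <= A i j, forall i, 0 < row_sum A i
    & forall j, 0 < col_sum A j].

Lemma row_normalize_sum (R : realType) (m n : nat) (A : 'M[R]_(m, n)) i :
  0 < row_sum A i -> row_sum (row_normalize A) i = 1.
Proof.
move=> Ai; under eq_bigr do rewrite mxE.
by rewrite -mulr_suml divff// gt_eqF.
Qed.

Lemma col_normalize_sum (R : realType) (m n : nat) (A : 'M[R]_(m, n)) j :
  0 < col_sum A j -> col_sum (col_normalize A) j = 1.
Proof.
move=> Aj; under eq_bigr do rewrite mxE.
by rewrite -mulr_suml divff// gt_eqF.
Qed.

Lemma row_normalize_full (R : realType) (m n : nat) (A : 'M[R]_(m, n)) :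
  nonneg_full A -> nonneg_full (row_normalize A).
Proof.
move=> [A0 Ar Ac].
have rA0 i j : 0 <= row_normalize A i j.
  by rewrite mxE divr_ge0// ltW.
split=> // [i|j]; first by rewrite row_normalize_sum.
rewrite lt_neqAle sumr_ge0 // andbT eq_sym psumr_neq0//=.
have := gt_eqF (Ac j); rewrite psumr_eq0// => /negbT/allPn[i i_in Aij].
apply/hasP; exists i => //; rewrite mxE divr_gt0//.
by rewrite lt_def A0 andbT.
Qed.

Lemma col_normalize_full (R : realType) (m n : nat) (A : 'M[R]_(m, n)) :
  nonneg_full A -> nonneg_full (col_normalize A).
Proof.
move=> [A0 Ar Ac].
have cA0 i j : 0 <= col_normalize A i j.
  by rewrite mxE divr_ge0// ltW.
split=> // [i|j]; last by rewrite col_normalize_sum.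
rewrite lt_neqAle sumr_ge0 // andbT eq_sym psumr_neq0//=.
have := gt_eqF (Ar i); rewrite psumr_eq0// => /negbT/allPn[j j_in Aij].
apply/hasP; exists j => //; rewrite mxE divr_gt0//.
by rewrite lt_def A0 andbT.
Qed.

Lemma sum_marginals (R : realType) (m n : nat) (p : 'M[R]_(m, n))
    (f : 'I_n -> R) (g : 'I_m -> R) :
  (forall i, row_sum p i = 1) ->
  \sum_i \sum_j p i j * (f j + g i) =
    \sum_j col_sum p j * f j + \sum_i g i.
Proof.
move=> p1.
have -> : \sum_j col_sum p j * f j = \sum_i \sum_j p i j * f j.
  by rewrite exchange_big; apply: eq_bigr => j _; rewrite mulr_suml.
rewrite -big_split; apply: eq_bigr => i _ /=.
under eq_bigr do rewrite mulrDr.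
by rewrite big_split -mulr_suml p1 mul1r.
Qed.

Lemma sum_col_sum (R : realType) (m n : nat) (p : 'M[R]_(m, n)) :
  (forall i, row_sum p i = 1) -> \sum_j col_sum p j = m%:R.
Proof.
move=> p1; rewrite exchange_big /=.
by under eq_bigr do rewrite p1; rewrite sumr_const card_ord.
Qed.

Definition col_entropy (R : realType) (m n : nat) (A : 'M[R]_(m, n)) : R :=
  \sum_j col_sum A j * ln (col_sum A j).

Section one_step.
Variables (R : realType) (m n : nat) (A : 'M[R]_(m, n)).
Hypotheses (A_full : nonneg_full A) (A_row : forall i, row_sum A i = 1).

Let T := col_normalize A.
Let A' := row_normalize T.

Lemma log_row_sums_le_col_entropy :
  - \sum_i ln (row_sum T i) <= col_entropy A.
Proof.
have [A0 _ c0] := A_full; have [_ r0 _] := col_normalize_full A_full.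
rewrite -subr_ge0 opprK -sum_marginals// -oppr_le0 -sumrN.
apply: sumr_le0 => i _; rewrite -sumrN.
apply: (@le_trans _ _ (\sum_j (A i j / col_sum A j / row_sum T i - A i j))).
  apply: ler_sum => j _; rewrite -lnM ?posrE// -mulrN -lnV ?posrE ?mulr_gt0//.
  apply: le_trans (mulr_ln_le _ _) _; rewrite ?invr_gt0 ?mulr_gt0//.
  by rewrite invfM mulrA.
rewrite sumrB A_row -mulr_suml.
rewrite (_ : \sum_j A i j / _ = row_sum T i).
  by rewrite divff ?subrr// gt_eqF.
by apply: eq_bigr => j _; rewrite mxE.
Qed.

Lemma col_entropy_le_log_row_sums :
  col_entropy A' <= - \sum_i ln (row_sum T i).
Proof.
have T_full := col_normalize_full A_full; have [T0 r0 _] := T_full.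
have [A'0 _ c'0] := row_normalize_full T_full; have [_ _ c0] := A_full.
have A'1 i : row_sum A' i = 1 by rewrite row_normalize_sum.
rewrite -subr_le0 opprK -sum_marginals//.
apply: (@le_trans _ _ (\sum_i \sum_j (T i j * col_sum A' j - A' i j))).
  apply: ler_sum => i _; apply: ler_sum => j _.
  rewrite -lnM ?posrE//; apply: le_trans (mulr_ln_le _ _) _ => //.
    by rewrite mulr_gt0.
  rewrite lerB// [A' i j]mxE le_eqVlt; apply/orP; left; apply/eqP.
  by field; rewrite gt_eqF.
rewrite exchange_big /=.
under eq_bigr => j _.
  rewrite sumrB -mulr_suml col_normalize_sum// mul1r subrr; over.
by rewrite big1.
Qed.

Lemma log_sums_le0 (p : 'M[R]_(m, n)) :
  (forall i j, 0 <= p i j) -> (forall i, row_sum p i = 1) ->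
  (forall j, 0 < col_sum p j) ->
  col_entropy p <= - \sum_i ln (row_sum T i) ->
  \sum_i \sum_j p i j * (ln (col_sum A j) + ln (row_sum T i)) <= 0.
Proof.
move=> p0 p1 q0 pT; rewrite sum_marginals// -lerBrDr sub0r.
apply: le_trans pT; have [_ _ c0] := A_full.
rewrite -subr_le0 -sumrB.
apply: (@le_trans _ _ (\sum_j (col_sum A j - col_sum p j))).
  apply: ler_sum => j _; rewrite -mulrBr -ln_div ?posrE//.
  apply: le_trans (mulr_ln_le (ltW (q0 j)) _) _; rewrite ?divr_gt0//.
  by rewrite mulrCA mulfV ?gt_eqF// mulr1.
by rewrite sumrB !sum_col_sum// subrr.
Qed.

Lemma col_sum_lower_bound (a : R) : 0 < a ->
  (forall j, a <= col_sum A j) -> forall j, a <= col_sum A' j.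
Proof.
move=> a0 aA j.
have T_full := col_normalize_full A_full; have [T0 r0 _] := T_full.
have [A0 _ c0] := A_full.
have ra i : row_sum T i <= a^-1.
  rewrite -[leRHS]mul1r -(A_row i) mulr_suml; apply: ler_sum => k _.
  by rewrite mxE ler_wpM2l// lef_pV2// posrE.
rewrite -[leLHS]mul1r -(col_normalize_sum (c0 j)) mulr_suml.
apply: ler_sum => i _; rewrite [leRHS]mxE ler_wpM2l//.
by rewrite -[leLHS]invrK lef_pV2// ?posrE ?invr_gt0.
Qed.

End one_step.

Section iteration.
Variables (R : realType) (m n : nat) (M : 'M[R]_(m, n)).
Hypothesis M_full : nonneg_full M.

Local Notation P := (sinkhorn_L M).

Lemma sinkhorn_L_full k : nonneg_full (P k).
Proof.
elim: k => [|k IHk]; apply: row_normalize_full => //.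
exact: col_normalize_full.
Qed.

Lemma sinkhorn_L_row_sum k i : row_sum (P k) i = 1.
Proof.
case: k => [|k]; apply: row_normalize_sum; first by have [] := M_full.
by have [] := col_normalize_full (sinkhorn_L_full k).
Qed.

Lemma sinkhorn_L_bounds k i j : 0 <= P k i j <= 1.
Proof.
have [P0 _ _] := sinkhorn_L_full k; rewrite P0 /=.
by rewrite -(sinkhorn_L_row_sum k i) (bigD1 j)//= lerDl sumr_ge0.
Qed.

Lemma sinkhorn_L_col_sum_lower_bound :
  exists2 a : R, 0 < a & forall k j, a <= col_sum (P k) j.
Proof.
have [_ _ c0] := sinkhorn_L_full 0.
have b0 : 0 < 1 + \sum_j (col_sum (P 0) j)^-1.
  by rewrite ltr_wpDr// sumr_ge0// => j _; rewrite invr_ge0 ltW.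
exists (1 + \sum_j (col_sum (P 0) j)^-1)^-1; first by rewrite invr_gt0.
elim=> [|k IHk] j; last first.
  apply: col_sum_lower_bound => //; [exact: sinkhorn_L_full| |].
    exact: sinkhorn_L_row_sum.
  by rewrite invr_gt0.
rewrite -[leRHS]invrK lef_pV2 ?posrE ?invr_gt0//.
rewrite (bigD1 j)//= addrCA lerDl addr_ge0// sumr_ge0// => l _.
by rewrite invr_ge0 ltW.
Qed.

Lemma col_entropy_sinkhorn_le k l :
  (k <= l)%N -> col_entropy (P l) <= col_entropy (P k).
Proof.
elim: l => [|l IHl]; first by rewrite leqn0 => /eqP->.
rewrite leq_eqVlt => /predU1P[->//|/IHl lk]; apply: le_trans _ lk.
have full := sinkhorn_L_full l; have row1 := sinkhorn_L_row_sum l.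
apply: le_trans (log_row_sums_le_col_entropy full row1).
exact: col_entropy_le_log_row_sums.
Qed.

Lemma sinkhorn_L_eq0 k l i j : (k <= l)%N -> P k i j = 0 -> P l i j = 0.
Proof.
elim: l => [|l IHl]; first by rewrite leqn0 => /eqP->.
rewrite leq_eqVlt => /predU1P[->//|/IHl{}IHl /IHl Pl].
by rewrite !mxE Pl !mul0r.
Qed.

End iteration.

Local Open Scope classical_set_scope.

Lemma ultra_bounded_cvg (R : realType) (G : set_system nat) (u : nat -> R) a b :
  UltraFilter G -> (forall k, a <= u k <= b) ->
  exists l : R, u @ G --> l.
Proof.
move=> GU uab.
have [|l [_ ul]] := @segment_compact R a b (u @ G) _.
  by apply: (@filterE _ G) => k; rewrite /= in_itv; exact: uab.
exists l => B Bl; have [//|GnB] := in_ultra_setVsetC (u @^-1` B) GU.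
by have [x [nBx Bx]] := ul (~` B) B GnB Bl.
Qed.

Lemma cvg_sum (R : realType) (T : Type) (F : set_system T) (I : finType)
    (f : I -> T -> R) (a : I -> R) : Filter F ->
  (forall i, f i x @[x --> F] --> a i) ->
  \sum_i f i x @[x --> F] --> \sum_i a i.
Proof. by move=> FF fa; apply: cvg_big => //; exact: add_continuous. Qed.

Lemma cvg_mxP (R : realType) (m n : nat) (T : Type) (F : set_system T)
    (A : T -> 'M[R]_(m, n)) (B : 'M[R]_(m, n)) : Filter F ->
  (forall i j, A x i j @[x --> F] --> B i j) -> A @ F --> B.
Proof.
move=> FF AB C [P BP PC].
have : \near F, forall i j, P i j (A F i j).
  by apply: filter_forall => i; apply: filter_forall => j; exact: AB (BP i j).
by apply: filterS => x /PC.
Qed.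

Section convergence.
Variables (R : realType) (m n : nat) (M : 'M[R]_(m, n)).
Hypothesis M_full : nonneg_full M.

Local Notation P := (sinkhorn_L M).

Section ultrafilter_limit.
Variables (G : set_system nat) (p : 'M[R]_(m, n)).
Hypotheses (GU : UltraFilter G) (ooG : \oo `<=` G).
Hypothesis Pp : forall i j, P k i j @[k --> G] --> p i j.

Let p_ge0 i j : 0 <= p i j.
Proof.
apply: (cvgr_to_ge (@Pp i j)); apply: filterE => k.
by have /andP[] := sinkhorn_L_bounds M_full k i j.
Qed.

Let p_le1 i j : p i j <= 1.
Proof.
apply: (cvgr_to_le (@Pp i j)); apply: filterE => k.
by have /andP[] := sinkhorn_L_bounds M_full k i j.
Qed.

Let p_row_sum i : row_sum p i = 1.
Proof.
have : row_sum (P k) i @[k --> G] --> row_sum p i by exact: cvg_sum.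
under eq_cvg do rewrite sinkhorn_L_row_sum//.
by move=> /cvg_unique-/(_ (@norm_hausdorff _ _) _ (cvg_cst _)) ->.
Qed.

Let p_cvg_col_sum j : col_sum (P k) j @[k --> G] --> col_sum p j.
Proof. exact: cvg_sum. Qed.

Let p_col_sum_gt0 j : 0 < col_sum p j.
Proof.
have [a a0 aP] := sinkhorn_L_col_sum_lower_bound M_full.
apply: lt_le_trans a0 _; apply: (cvgr_to_ge (@p_cvg_col_sum j)).
by apply: filterE => k; exact: aP.
Qed.

Let col_entropy_limit_le k : col_entropy p <= col_entropy (P k).
Proof.
have cvg_entropy : col_entropy (P l) @[l --> G] --> col_entropy p.
  apply: cvg_sum => j; apply: cvgM; first exact: p_cvg_col_sum.
  exact: continuous_cvg (continuous_ln (p_col_sum_gt0 j)) (@p_cvg_col_sum j).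
apply: (cvgr_to_le cvg_entropy); apply: ooG; exists k => // l /= kl.
exact: col_entropy_sinkhorn_le.
Qed.

(* Zero entries persist along the iteration, hence in the limit. *)
Let P_neq0 k i j : p i j != 0 -> P k i j != 0.
Proof.
apply: contra_neq => Pk0; apply: le_anti; rewrite p_ge0 andbT.
apply: (cvgr_to_le (@Pp i j)); apply: ooG; exists k => // l /= kl.
by rewrite (sinkhorn_L_eq0 kl Pk0).
Qed.

Let log_likelihood k : R := \sum_i \sum_j p i j * ln (P k i j).

Let log_likelihood_nondecreasing k l : (k <= l)%N ->
  log_likelihood k <= log_likelihood l.
Proof.
elim: l => [|l IHl]; first by rewrite leqn0 => /eqP->.
rewrite leq_eqVlt => /predU1P[->//|/IHl{}IHl]; apply: le_trans IHl _.
have full := sinkhorn_L_full M_full l.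
have [P0 _ c0] := full; have [_ r0 _] := col_normalize_full full.
rewrite -subr_ge0 -oppr_le0 opprB -sumrB.
have row1 := sinkhorn_L_row_sum M_full l.
apply: le_trans (log_sums_le0 full row1 p_ge0 p_row_sum p_col_sum_gt0
  (le_trans (col_entropy_limit_le l.+1)
    (col_entropy_le_log_row_sums full))).
apply: ler_sum => i _; rewrite -sumrB; apply: ler_sum => j _.
have [->|pij] := eqVneq (p i j) 0; first by rewrite !mul0r subrr.
have Pij : 0 < P l i j by rewrite lt_def P_neq0// P0.
have -> : P l.+1 i j =
    P l i j / col_sum (P l) j / row_sum (col_normalize (P l)) i.
  by rewrite mxE [in LHS]mxE.
rewrite !ln_div ?posrE ?divr_gt0// -mulrBr.
by rewrite le_eqVlt; apply/orP; left; apply/eqP; ring.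
Qed.

Let cvg_log_likelihood :
  log_likelihood k @[k --> G] --> \sum_i \sum_j p i j * ln (p i j).
Proof.
apply: cvg_sum => i; apply: cvg_sum => j.
have [->|pij] := eqVneq (p i j) 0.
  by under eq_cvg do rewrite mul0r; rewrite mul0r; exact: cvg_cst.
apply: cvgM (cvg_cst _) _; apply: continuous_cvg (@Pp i j).
apply: continuous_ln.
by rewrite lt_def pij p_ge0.
Qed.

Let dist_le k i j : (p i j - P k i j) ^+ 2 <=
  4 * (\sum_i \sum_j p i j * ln (p i j) - log_likelihood k).
Proof.
have /andP[P0 P1] := sinkhorn_L_bounds M_full k i j.
set d := Num.sqrt (p i j) - Num.sqrt (P k i j).
have -> : p i j - P k i j = d * (Num.sqrt (p i j) + Num.sqrt (P k i j)).
  by rewrite /d -subr_sqr !sqr_sqrtr.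
rewrite exprMn mulrC ler_pM ?sqr_ge0//.
  have : Num.sqrt (p i j) <= 1 by rewrite -sqrtr1 ler_wsqrtr.
  have : Num.sqrt (P k i j) <= 1 by rewrite -sqrtr1 ler_wsqrtr.
  have := sqrtr_ge0 (p i j); have := sqrtr_ge0 (P k i j).
  by nra.
pose h i j := (Num.sqrt (p i j) - Num.sqrt (P k i j)) ^+ 2.
apply: (@le_trans _ _ (\sum_i \sum_j h i j)).
  rewrite (bigD1 i)//= (bigD1 j)//= -addrA lerDl addr_ge0// sumr_ge0// => *.
    exact: sqr_ge0.
  by rewrite sumr_ge0// => *; exact: sqr_ge0.
rewrite -sumrB; apply: ler_sum => i' _.
have -> : \sum_j h i' j = \sum_j (p i' j - P k i' j + h i' j).
  by rewrite big_split sumrB p_row_sum sinkhorn_L_row_sum//= subrr add0r.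
rewrite -sumrB; apply: ler_sum => j' _; rewrite -mulrBr.
apply: hellinger_le_relative_entropy => //; last exact: P_neq0.
by have /andP[] := sinkhorn_L_bounds M_full k i' j'.
Qed.

Lemma sinkhorn_L_cvg_ultra_limit i j : P k i j @[k --> \oo] --> p i j.
Proof.
apply/cvgrPdist_lt => e e0.
have e4 : 0 < e ^+ 2 / 4 by rewrite divr_gt0// exprn_gt0.
have /cvgrPdist_lt/(_ _ e4)/filter_ex[k kP] := cvg_log_likelihood.
exists k => // l /= kl.
rewrite -(@ltr_pXn2r _ 2) ?nnegrE// ?ltW// real_normK ?num_real//.
apply: le_lt_trans (dist_le l i j) _.
have := log_likelihood_nondecreasing kl.
by move: (le_lt_trans (ler_norm _) kP); lra.
Qed.

Lemma sinkhorn_ultra_limit : [/\ forall i j, 0 <= p i j,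
  forall i, row_sum p i = 1, forall j, 0 < col_sum p j &
  forall i j, P k i j @[k --> \oo] --> p i j].
Proof. by split=> //; exact: sinkhorn_L_cvg_ultra_limit. Qed.

End ultrafilter_limit.

Theorem sinkhorn_L_cvg : exists p : 'M[R]_(m, n),
  [/\ forall i j, 0 <= p i j, forall i, row_sum p i = 1,
  forall j, 0 < col_sum p j & forall i j, P k i j @[k --> \oo] --> p i j].
Proof.
have [G [GU ooG]] := ultraFilterLemma eventually_filter.
have Pl i j : exists l : R, P k i j @[k --> G] --> l.
  by apply: ultra_bounded_cvg => k; exact: sinkhorn_L_bounds.
exists (\matrix_(i, j) sval (cid (Pl i j))).
apply: (sinkhorn_ultra_limit GU ooG) => i j; rewrite mxE.
exact: svalP (cid (Pl i j)).
Qed.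

End convergence.

Lemma limn_mxE (R : realType) (m n : nat) (A : nat -> 'M[R]_(m, n))
    (B : 'M[R]_(m, n)) :
  (forall i j, A k i j @[k --> \oo] --> B i j) -> limn A = B.
Proof.
move=> AB; have /cvgP : A @ \oo --> B by exact: cvg_mxP.
move=> A_cvg; apply/matrixP => i j.
have : A k i j @[k --> \oo] --> limn A i j.
  exact: continuous_cvg (@coord_continuous _ _ _ i j _) A_cvg.
by move=> /cvg_unique-/(_ (@norm_hausdorff _ _) _ (AB i j)) ->.
Qed.

Lemma limit_T_col_normalize (R : realType) (m n : nat) (M p : 'M[R]_(m, n)) :
  (forall j, 0 < col_sum p j) ->
  (forall i j, sinkhorn_L M k i j @[k --> \oo] --> p i j) ->
  limit_T M = col_normalize p.
Proof.
move=> p0 Pp; apply: limn_mxE => i j; rewrite mxE.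
under eq_cvg do rewrite mxE.
apply: cvgM => //; apply: cvgV; first by rewrite gt_eqF.
by apply: cvg_sum => k; exact: Pp.
Qed.

Lemma sum_mul_col_normalize_ge1 (R : realType) (n : nat) (p : 'M[R]_n) :
  (0 < n)%N -> (forall i, row_sum p i = 1) -> (forall j, 0 < col_sum p j) ->
  1 <= \sum_i \sum_j p i j * col_normalize p i j.
Proof.
move=> n0 p1 p0; rewrite exchange_big /=.
have n0R : 0 < n%:R :> R by rewrite ltr0n.
have -> : 1 = \sum_j col_sum p j / n%:R.
  by rewrite -mulr_suml sum_col_sum// divff// gt_eqF.
apply: ler_sum => j _; have c0 := p0 j; set c := col_sum p j in c0 *.
have -> : \sum_i p i j * col_normalize p i j = (\sum_i p i j ^+ 2) / c.
  by rewrite mulr_suml; apply: eq_bigr => i _; rewrite mxE expr2 mulrA.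
rewrite ler_pdivlMr//.
(* Cauchy-Schwarz, as nonnegativity of the variance of the [j]-th column. *)
have : 0 <= \sum_i (p i j - c / n%:R) ^+ 2.
  by rewrite sumr_ge0// => i _; exact: sqr_ge0.
have -> : \sum_i (p i j - c / n%:R) ^+ 2 =
    \sum_i p i j ^+ 2 - c / n%:R * c.
  rewrite (eq_bigr (fun i => p i j ^+ 2 - (c / n%:R) *+ 2 * p i j +
    (c / n%:R) ^+ 2)) => [|i _]; last by ring.
  rewrite big_split sumrB -mulr_sumr sumr_const card_ord /= -/c -mulr_natl.
  by field; rewrite gt_eqF.
by rewrite subr_ge0.
Qed.

Lemma row_normalize_const (R : realType) (m n : nat) (a : R) :
  a != 0 -> row_normalize (const_mx a : 'M[R]_(m, n)) = const_mx n%:R^-1.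
Proof.
move=> a0; apply/matrixP => i j; rewrite !mxE; under eq_bigr do rewrite mxE.
by rewrite sumr_const card_ord -[a *+ n]mulr_natl invfM mulrCA mulfV// mulr1.
Qed.

Lemma col_normalize_const (R : realType) (m n : nat) (a : R) :
  a != 0 -> col_normalize (const_mx a : 'M[R]_(m, n)) = const_mx m%:R^-1.
Proof.
move=> a0; apply/matrixP => i j; rewrite !mxE; under eq_bigr do rewrite mxE.
by rewrite sumr_const card_ord -[a *+ m]mulr_natl invfM mulrCA mulfV// mulr1.
Qed.

Lemma sinkhorn_L_const (R : realType) (n : nat) (a : R) k :
  (0 < n)%N -> a != 0 ->
  sinkhorn_L (const_mx a : 'M[R]_n) k = const_mx n%:R^-1.
Proof.
move=> n0 a0; have n0R : n%:R^-1 != 0 :> R by rewrite invr_eq0 pnatr_eq0 -lt0n.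
elim: k => [|k IHk] /=; first exact: row_normalize_const.
by rewrite IHk col_normalize_const// row_normalize_const.
Qed.

Local Close Scope classical_set_scope.

Theorem proposition27 (R : realType) (n : nat) (M : 'M[R]_n)
  (n_gt0 : (0 < n)%N)
  (M_ge0 : forall i j, 0 <= M i j)
  (M_row : forall i, row i M != 0)
  (M_col : forall j, col j M != 0) :
  n%:R^-1 <= cooperative_index M /\
  ((forall i j k l, M i j = M k l) -> cooperative_index M = n%:R^-1).
Proof.
have n0 : n%:R != 0 :> R by rewrite pnatr_eq0 -lt0n.
have M_full : nonneg_full M.
  split=> // [i|j]; rewrite lt_def sumr_ge0// andbT psumr_neq0//.
    have /rV0Pn[j] := M_row i; rewrite mxE => Mij.
    by apply/hasP; exists j; rewrite ?mem_index_enum//= lt_def Mij M_ge0.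
  have /cV0Pn[i] := M_col j; rewrite mxE => Mij.
  by apply/hasP; exists i; rewrite ?mem_index_enum//= lt_def Mij M_ge0.
have [p [p_ge0 p_row p_col Pp]] := sinkhorn_L_cvg M_full.
rewrite /cooperative_index (limit_T_col_normalize p_col Pp).
rewrite /limit_L (limn_mxE Pp); split=> [|M_const].
  rewrite -[leLHS]mulr1 ler_wpM2l ?invr_ge0//.
  exact: sum_mul_col_normalize_ge1.
pose i0 := Ordinal n_gt0; have M_eq : M = const_mx (M i0 i0).
  by apply/matrixP => i j; rewrite mxE; exact: M_const.
have M0 : M i0 i0 != 0.
  apply: contra_neq (M_row i0) => M00.
  by rewrite M_eq M00; apply/rowP => j; rewrite !mxE.
have p_eq : p = const_mx n%:R^-1.
  rewrite -(limn_mxE Pp) M_eq; apply: limn_mxE => i j.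
  by under eq_cvg do rewrite sinkhorn_L_const//; exact: cvg_cst.
rewrite p_eq col_normalize_const ?invr_eq0//.
under eq_bigr do under eq_bigr do rewrite !mxE.
by rewrite !sumr_const !card_ord -mulrnA -[X in _ * X]mulr_natl natrM; field.
Qed.
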